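(* Let $n\in\{0,1,2,\dots\}$. Then the minimum $\hat{E}_n$ of $ME_{n,\delta}$ over $\delta\in(0,n+1)$ is given by $$\hat{E}_n=\frac{1}{e}\Bigl(e-\sum_{k=0}^n\frac{1}{k!}\Bigr),$$ and is assumed for $$\delta=\delta_{n,E}=\Bigl(n!\Bigl(e-\sum_{k=0}^n\frac{1}{k!}\Bigr)\Bigr)^{-1}.$$
   Context: For $n\in\{0,1,2,\dots\}$ and $\delta\in(0,n+1)$, $$E_{n,\delta}(s)=\frac{1-\Bigl(1+\frac{s^1}{1!}+\dots+\frac{s^n}{n!}\Bigr)e^{-s}}{s^{\delta}}\quad(s>0),\qquad E_{n,\delta}(0)=0,$$ and $ME_{n,\delta}=\max_{s\ge 0}E_{n,\delta}(s)$ (the maximum is attained). *)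

(* Defs.v *)
From mathcomp Require Import all_boot all_order all_algebra.
From mathcomp Require Import all_classical all_reals all_analysis.
From mathcomp Require Import ring lra.

Set Implicit Arguments.
Unset Strict Implicit.
Unset Printing Implicit Defensive.

Import Order.TTheory GRing.Theory Num.Theory.
Import numFieldNormedType.Exports.

Local Open Scope classical_set_scope.
Local Open Scope ring_scope.

Definition is_maximum (R : realType) (A : set R) (m : R) : Prop :=
  A m /\ ubound A m.

Definition is_minimum (R : realType) (A : set R) (m : R) : Prop :=
  A m /\ lbound A m.

Definition exp_sum (R : realType) (n : nat) (s : R) : R :=
  \sum_(k < n.+1) s ^+ k / k`!%:R.

(* Only [s >= 0] is meaningful; the value 0 for [s < 0] is a dummy. *)
Definition E (R : realType) (n : nat) (delta s : R) : R :=
  if 0 < s then (1 - exp_sum n s * expR (- s)) / s `^ delta else 0.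

(* For [0 < delta < n + 1] this supremum is attained, see [ME_is_maximum]. *)
Definition ME (R : realType) (n : nat) (delta : R) : R :=
  sup [set E n delta s | s in `[0, +oo[].

Section Attained.
Variables (R : realType) (n : nat).
Implicit Types s delta : R.

Let F (m : nat) s : R := 1 - exp_sum m s * expR (- s).

Let is_derive_F m s : is_derive s 1 (F m) (s ^+ m / m`!%:R * expR (- s)).
Proof.
have dexpN : is_derive s 1 (fun x : R => expR (- x)) (- expR (- s)).
  have := @is_derive1_comp R expR (-%R) s _ _ (is_derive_expR _) (is_deriveNid _ _).
  by rewrite mulrN1.
elim: m => [|m IH].
  have -> : F 0 = cst 1 - (fun x : R => expR (- x)).
    by apply/funext => x; rewrite /F /exp_sum big_ord1 expr0 fact0 divr1 mul1r.
  apply: is_derive_eq.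
  by rewrite expr0 fact0 divr1 mul1r sub0r opprK.
have -> : F m.+1 =
    F m - (m.+1`!%:R)^-1 \*: ((@id R ^+ m.+1) * (fun x : R => expR (- x))).
  apply/funext => x; rewrite /F /exp_sum big_ord_recr /=.
  have scE (a b : R) : a *: (b : R^o) = a * b by [].
  rewrite !fctE /= scE mulrDl opprD addrA.
  by rewrite [x ^+ _ / _]mulrC mulrA.
apply: is_derive_eq.
rewrite !fctE /= factS natrM.
have scE (a b : R) : a *: (b : R^o) = a * b by [].
rewrite !scE mulr1.
have f0 : (m`!%:R : R) != 0 by rewrite pnatr_eq0 -lt0n fact_gt0.
have m0 : (m.+1%:R : R) != 0 by rewrite pnatr_eq0.
move: (m.+1%:R : R) (m`!%:R : R) (expR (- s)) m0 f0 => u v w u0 v0.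
by rewrite exprS; field; rewrite u0 v0.
Qed.

Let F0 m : F m 0 = 0.
Proof.
rewrite /F /exp_sum big_ord_recl expr0 fact0 divr1 oppr0 expR0 mulr1 big1 ?addr0 ?subrr//.
by move=> i _; rewrite expr0n /= mul0r.
Qed.

Let F_continuous m : continuous (F m).
Proof.
move=> s; apply: differentiable_continuous; apply/derivable1_diffP.
exact: (@ex_derive _ _ _ _ _ _ _ (is_derive_F m s)).
Qed.

Let F_bounds s : 0 < s -> 0 < F n s <= s ^+ n.+1 /\ F n s <= 1.
Proof.
move=> s0; split; last first.
  rewrite /F lerBlDr lerDl mulr_ge0 ?expR_ge0// sumr_ge0// => i _.
  by rewrite divr_ge0 ?exprn_ge0// ltW.
have [|c] := @MVT R (F n) (fun s => s ^+ n / n`!%:R * expR (- s)) 0 s s0 (fun x _ => is_derive_F n x).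
  exact: continuous_subspaceT (@F_continuous n).
rewrite in_itv/= => /andP[c0 cs]; rewrite F0 !subr0 => ->.
rewrite exprSr; apply/andP; split.
  by rewrite !mulr_gt0 ?expR_gt0 ?invr_gt0 ?exprn_gt0 ?ltr0n ?fact_gt0.
rewrite ler_wpM2r ?(ltW s0)// -[leRHS]mulr1 ler_pM ?expR_ge0 ?divr_ge0 ?exprn_ge0 ?(ltW c0)//.
  rewrite ler_pdivrMr ?ltr0n ?fact_gt0//.
  rewrite (@le_trans _ _ (s ^+ n))// ?lerXn2r ?nnegrE ?(ltW c0) ?(ltW s0) ?(ltW cs)//.
  by rewrite ler_peMr ?exprn_ge0 ?(ltW s0)// ler1n fact_gt0.
by rewrite -expR0 ler_expR oppr_le0 ltW.
Qed.

Lemma E_has_maximum delta : 0 < delta < n.+1%:R ->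
  exists m, is_maximum [set E n delta s | s in `[0, +oo[] m.
Proof.
move=> /andP[d0 dn].
pose e := E n delta 1.
have Epos s : 0 < s -> E n delta s = F n s / s `^ delta by rewrite /E => ->.
have e0 : 0 < e.
  by rewrite /e Epos// powR1 divr1; have [/andP[]] := F_bounds ltr01.
have nd : 0 < n.+1%:R - delta by rewrite subr_gt0.
pose a := Num.min (e `^ (n.+1%:R - delta)^-1) 1.
pose b := Num.max (e^-1 `^ delta^-1) 1.
have a0 : 0 < a by rewrite lt_min powR_gt0//= ltr01.
have ab : a <= b by rewrite (@le_trans _ _ 1)// ?ge_min ?le_max lexx orbT.
have [|c] := @EVT_max R (fun s => F n s / s `^ delta) a b ab.
  apply: derivable_within_continuous => x; rewrite in_itv/= => /andP[ax _].
  have x0 := lt_le_trans a0 ax.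
  apply: derivableM; first exact: (@ex_derive _ _ _ _ _ _ _ (is_derive_F n x)).
  apply: derivableV; first by rewrite gt_eqF// powR_gt0.
  exact: (@ex_derive _ _ _ _ _ _ _ (is_derive1_powR _ x0)).
rewrite in_itv/= => /andP[ac cb] cmax.
have c0 := lt_le_trans a0 ac.
have ec : e <= E n delta c.
  rewrite /e !Epos//; apply: cmax.
  by rewrite in_itv/= ge_min le_max lexx !orbT.
exists (E n delta c); split; first by exists c => //=; rewrite in_itv/= ltW.
move=> _ [s _ <-].
have [s0|s0] := ltP 0 s; last first.
  by rewrite {1}/E ltNge s0/= (le_trans (ltW e0)).
have [/andP[_ Fs] Fs1] := F_bounds s0.
have sd0 : 0 < s `^ delta by rewrite powR_gt0.
have [as_|sa] := leP a s; last first.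
  apply: le_trans ec; rewrite Epos// ler_pdivrMr// (le_trans Fs)//.
  rewrite -(powR_mulrn _ (ltW s0)) -{1}[n.+1%:R](subrK delta) powRD; last first.
    by rewrite (gt_eqF s0) implybT.
  rewrite ler_wpM2r ?(ltW sd0)//.
  have -> : e = (e `^ (n.+1%:R - delta)^-1) `^ (n.+1%:R - delta).
    by rewrite -powRrM mulVf ?gt_eqF// powRr1// ltW.
  apply: ge0_ler_powR; rewrite ?nnegrE ?powR_ge0 ?(ltW s0) ?(ltW nd)//.
  by rewrite ltW// (lt_le_trans sa)// ge_min lexx.
have [sb|bs] := leP s b.
  by rewrite !Epos//; apply: cmax; rewrite in_itv/= as_.
apply: le_trans ec; rewrite Epos// ler_pdivrMr// (le_trans Fs1)//.
rewrite mulrC -ler_pdivrMr// mul1r.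
have -> : e^-1 = (e^-1 `^ delta^-1) `^ delta.
  by rewrite -powRrM mulVf ?gt_eqF// powRr1// invr_ge0 ltW.
apply: ge0_ler_powR; rewrite ?nnegrE ?powR_ge0 ?(ltW s0) ?(ltW d0)//.
by rewrite ltW// (le_lt_trans _ bs)// le_max lexx.
Qed.

Lemma ME_is_maximum delta : 0 < delta < n.+1%:R ->
  is_maximum [set E n delta s | s in `[0, +oo[] (ME n delta).
Proof.
move=> /E_has_maximum[m [Am um]].
suff -> : ME n delta = m by split.
apply/eqP; rewrite eq_le; apply/andP; split.
  by apply: ge_sup => //; exists m.
by apply: sup_upper_bound => //; split; [exists m | exists m].
Qed.

End Attained.

(* Main.v *)
Require Import Defs.
From mathcomp Require Import all_boot all_order all_algebra.
From mathcomp Require Import all_classical all_reals all_analysis.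
From mathcomp Require Import ring lra.

(** For every [delta] the value of [E n delta] at [s = 1] is the number
    [Ehat], because [1 `^ delta = 1]; hence [ME n delta >= Ehat] for all
    [delta], and it remains to find one [delta] for which [1] is a global
    maximum point of [E n delta].

    The numerator [F s] of [E n delta s] is the Poisson tail, with
    [F' s = s ^+ n / n! * expR (- s)].  Therefore [F s / s `^ delta] has a
    derivative of the sign of [h s = s * F' s - delta * F s]
    ([is_derive_tail_quotient]), and [1] can only be a maximum point if
    [h 1 = 0]; solving for [delta] gives [F' 1 / F 1], which is [deltaE].
    It lies below [n + 1] because the tail of order [n + 1] is positive at [1].

    With this choice [h 0 = h 1 = 0], while [h' s] is a positive multiple of
    [n + 1 - delta - s], so that [h] increases and then decreases.  Hence [h] is
    nonnegative on [[0, 1]] and nonpositive beyond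
    ([slope_excess_sign]), which makes [1] a global maximum point. *)

Set Implicit Arguments.
Unset Strict Implicit.
Unset Printing Implicit Defensive.

Import Order.TTheory GRing.Theory Num.Theory.
Import numFieldNormedType.Exports.

Local Open Scope classical_set_scope.
Local Open Scope ring_scope.

(** The probability that a Poisson variable of mean [s] exceeds [m]. *)
Definition poisson_tail (R : realType) (m : nat) (s : R) : R :=
  1 - exp_sum m s * expR (- s).

Definition poisson_mass (R : realType) (m : nat) (s : R) : R :=
  s ^+ m / m`!%:R * expR (- s).

Lemma fact_neq0 (R : realType) (m : nat) : (m`!%:R : R) != 0.
Proof. by rewrite pnatr_eq0 -lt0n fact_gt0. Qed.

Lemma poisson_mass_gt0 (R : realType) (m : nat) (s : R) :
  0 < s -> 0 < poisson_mass m s.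
Proof.
by move=> s0; rewrite !mulr_gt0 ?expR_gt0 ?invr_gt0 ?exprn_gt0 ?ltr0n ?fact_gt0.
Qed.

Lemma poisson_tailS (R : realType) (m : nat) (s : R) :
  poisson_tail m.+1 s = poisson_tail m s - poisson_mass m.+1 s.
Proof.
by rewrite /poisson_tail /exp_sum big_ord_recr /= mulrDl opprD addrA.
Qed.

Lemma is_derive_expRN (R : realType) (s : R) :
  is_derive s 1 (fun x : R => expR (- x)) (- expR (- s)).
Proof.
have := @is_derive1_comp R expR (-%R) s _ _ (is_derive_expR _) (is_deriveNid _ _).
by rewrite mulrN1.
Qed.

Lemma is_derive_poisson_massS (R : realType) (m : nat) (s : R) :
  is_derive s 1 (@poisson_mass R m.+1) (poisson_mass m s - poisson_mass m.+1 s).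
Proof.
have dexpN := is_derive_expRN s.
have -> : @poisson_mass R m.+1 =
    (m.+1`!%:R)^-1 \*: ((@id R ^+ m.+1) * (fun x : R => expR (- x))).
  apply/funext => x; rewrite !fctE /= /poisson_mass.
  by rewrite [x ^+ _ / _]mulrC -mulrA.
apply: is_derive_eq.
rewrite !fctE /= /poisson_mass factS natrM.
have scE (a b : R) : a *: (b : R^o) = a * b by [].
rewrite !scE mulr1.
have f0 := fact_neq0 R m.
have m0 : (m.+1%:R : R) != 0 by rewrite pnatr_eq0.
move: (m.+1%:R : R) (m`!%:R : R) (expR (- s)) m0 f0 => u v w u0 v0.
by rewrite exprS; field; rewrite u0 v0.
Qed.

(** The sum defining the derivative telescopes, only its last term survives. *)
Lemma is_derive_poisson_tail (R : realType) (m : nat) (s : R) :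
  is_derive s 1 (@poisson_tail R m) (poisson_mass m s).
Proof.
elim: m => [|m IH].
  have dexpN := is_derive_expRN s.
  have -> : @poisson_tail R 0 = cst 1 - (fun x : R => expR (- x)).
    apply/funext => x; rewrite /poisson_tail /exp_sum big_ord1.
    by rewrite expr0 fact0 divr1 mul1r.
  apply: is_derive_eq.
  by rewrite /poisson_mass expr0 fact0 divr1 mul1r sub0r opprK.
have dmass := is_derive_poisson_massS m s.
have -> : @poisson_tail R m.+1 = @poisson_tail R m - @poisson_mass R m.+1.
  by apply/funext => x; rewrite poisson_tailS.
by apply: is_derive_eq; rewrite opprB addrC subrK.
Qed.

Lemma poisson_tail0 (R : realType) (m : nat) : poisson_tail m (0 : R) = 0.
Proof.
rewrite /poisson_tail /exp_sum big_ord_recl expr0 fact0 divr1 oppr0 expR0 mulr1.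
by rewrite big1 ?addr0 ?subrr// => i _; rewrite expr0n /= mul0r.
Qed.

(** The mean value theorem with the derivative given as a function on the whole
    segment, where continuity comes for free. *)
Lemma MVT_derive_on (R : realType) (f df : R -> R) (a b : R) : a < b ->
  (forall x, a <= x <= b -> is_derive x (1 : R) f (df x)) ->
  exists2 c, a < c < b & f b - f a = df c * (b - a).
Proof.
move=> ab dfP.
have dfoo x : x \in `]a, b[ -> is_derive x (1 : R) f (df x).
  by rewrite in_itv/= => /andP[ax xb]; apply: dfP; rewrite !ltW.
have fab : {within `[a, b], continuous f}.
  apply: derivable_within_continuous => x; rewrite in_itv/= => xab.
  exact: (@ex_derive _ _ _ _ _ _ _ (dfP x xab)).
have [c] := MVT ab dfoo fab.
by rewrite in_itv/= => cab fE; exists c.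
Qed.

Lemma poisson_tail_gt0 (R : realType) (m : nat) (s : R) :
  0 < s -> 0 < poisson_tail m s.
Proof.
move=> s0; have [c /andP[c0 _]] :=
  MVT_derive_on s0 (fun x _ => is_derive_poisson_tail m x).
rewrite poisson_tail0 !subr0 => ->.
by rewrite mulr_gt0// poisson_mass_gt0.
Qed.

Lemma mul_poisson_mass (R : realType) (n : nat) (s : R) :
  s * poisson_mass n s = n.+1%:R * poisson_mass n.+1 s.
Proof.
have f0 := fact_neq0 R n.
have m0 : (n.+1%:R : R) != 0 by rewrite pnatr_eq0.
rewrite /poisson_mass factS natrM exprS.
move: (n.+1%:R : R) (n`!%:R : R) m0 f0 => u v u0 v0.
by field; rewrite u0 v0.
Qed.

(** [s * F' s - delta * F s] with [F] the Poisson tail of order [n]; up to a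
    positive factor, the derivative of [E n delta].  The first term is rewritten
    with [mul_poisson_mass], because the mass of positive order has a
    derivative formula that needs no case distinction on [n]. *)
Definition slope_excess (R : realType) (n : nat) (delta s : R) : R :=
  n.+1%:R * poisson_mass n.+1 s - delta * poisson_tail n s.

Lemma is_derive_slope_excess (R : realType) (n : nat) (delta s : R) :
  is_derive s 1 (slope_excess n delta)
    (poisson_mass n s * (n.+1%:R - delta - s)).
Proof.
have dmass := is_derive_poisson_massS n s.
have dtail := is_derive_poisson_tail n s.
have -> : slope_excess n delta =
    n.+1%:R \*: @poisson_mass R n.+1 - delta \*: @poisson_tail R n by [].
apply: is_derive_eq.
have scE (a b : R) : a *: (b : R^o) = a * b by [].
rewrite !scE mulrBr -mul_poisson_mass; ring.
Qed.

(** The derivative of [slope_excess n delta] is positive before the point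
    [n + 1 - delta] and negative after it, and the zeros at [0] and [1] force
    this point to lie in between. *)
Lemma slope_excess_sign (R : realType) (n : nat) (delta : R) :
  slope_excess n delta 1 = 0 ->
  (forall s, 0 <= s <= 1 -> 0 <= slope_excess n delta s) /\
  (forall s, 1 <= s -> slope_excess n delta s <= 0).
Proof.
set h := slope_excess n delta => h1.
have h0 : h 0 = 0.
  rewrite /h /slope_excess poisson_tail0 mulr0 subr0.
  by rewrite /poisson_mass expr0n /= !mul0r mulr0.
have hMVT a b : a < b -> exists2 c, a < c < b &
    h b - h a = poisson_mass n c * (n.+1%:R - delta - c) * (b - a).
  by move=> ab; apply: MVT_derive_on => // x _; exact: is_derive_slope_excess.
split=> s.
- case/andP; rewrite le_eqVlt => /predU1P[<-|s0]; first by rewrite h0.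
  rewrite le_eqVlt => /predU1P[->|s1]; first by rewrite h1.
  (* A negative value would make [h] decrease before [s] and increase after. *)
  rewrite leNgt; apply/negP => hs.
  have [x /andP[x0 xs]] := hMVT _ _ s0; rewrite h0 !subr0 => hx.
  have [y /andP[sy y1]] := hMVT _ _ s1; rewrite h1 sub0r => hy.
  move: (hs); rewrite hx pmulr_llt0// pmulr_rlt0 ?poisson_mass_gt0// => ltx.
  have : 0 < - h s by rewrite oppr_gt0.
  rewrite hy pmulr_lgt0 ?subr_gt0// pmulr_rgt0 ?poisson_mass_gt0//; last lra.
  lra.
- rewrite le_eqVlt => /predU1P[<-|s1]; first by rewrite h1.
  have [x /andP[x0 x1]] := hMVT _ _ ltr01.
  rewrite h0 h1 !subr0 mulr1 => /esym/eqP.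
  rewrite mulf_eq0 gt_eqF ?poisson_mass_gt0//= => /eqP cx.
  have [y /andP[y1 ys]] := hMVT _ _ s1; rewrite h1 subr0 => ->.
  rewrite ltW// pmulr_llt0 ?subr_gt0// pmulr_rlt0 ?poisson_mass_gt0//; lra.
Qed.

Lemma is_derive_tail_quotient (R : realType) (n : nat) (delta s : R) : 0 < s ->
  is_derive s 1 (fun x : R => poisson_tail n x * x `^ (- delta))
    (s `^ (- delta - 1) * slope_excess n delta s).
Proof.
move=> s0.
have dtail := is_derive_poisson_tail n s.
have dpow := is_derive1_powR (- delta) s0.
have -> : (fun x : R => poisson_tail n x * x `^ (- delta)) =
  @poisson_tail R n * (fun x : R => x `^ (- delta)) by [].
apply: is_derive_eq.
have scE (a b : R) : a *: (b : R^o) = a * b by [].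
rewrite !scE /slope_excess -mul_poisson_mass.
have -> : s `^ (- delta) = s `^ (- delta - 1) * s.
  rewrite -{3}(powRr1 (ltW s0)) -powRD ?subrK//.
  by rewrite (gt_eqF s0) implybT.
ring.
Qed.

Lemma E_poisson_tail (R : realType) (n : nat) (delta s : R) : 0 < s ->
  E n delta s = poisson_tail n s * s `^ (- delta).
Proof. by move=> s0; rewrite /E s0 powRN. Qed.

Lemma E1 (R : realType) (n : nat) (delta : R) :
  E n delta 1 = poisson_tail n 1.
Proof. by rewrite E_poisson_tail ?ltr01// powR1 mulr1. Qed.

(** The derivative of [E n delta] has the sign of [slope_excess n delta], so
    that [E n delta] rises on []0, 1]] and falls afterwards. *)
Lemma E_le_E1 (R : realType) (n : nat) (delta s : R) :
  slope_excess n delta 1 = 0 -> E n delta s <= E n delta 1.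
Proof.
move=> /slope_excess_sign[hpos hneg].
have [s0|s0] := ltP 0 s; last first.
  by rewrite E1 /E ltNge s0 /= ltW// poisson_tail_gt0.
rewrite !E_poisson_tail//.
have qMVT a b : 0 < a -> a < b -> exists2 c, a < c < b &
    poisson_tail n b * b `^ (- delta) - poisson_tail n a * a `^ (- delta) =
    c `^ (- delta - 1) * slope_excess n delta c * (b - a).
  move=> a0 ab.
  apply: (MVT_derive_on (f := fun x => poisson_tail n x * x `^ (- delta))) => //.
  move=> x /andP[ax _].
  exact/is_derive_tail_quotient/(lt_le_trans a0).
have [s1|s1|->//] := ltgtP s 1.
- have [c /andP[sc c1] qE] := qMVT _ _ s0 s1.
  rewrite -subr_ge0 qE !mulr_ge0 ?powR_ge0 ?hpos ?subr_ge0 ?(ltW s1)//.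
  by rewrite (ltW c1) (ltW (lt_trans s0 sc)).
- have [c /andP[c1 cs] qE] := qMVT _ _ ltr01 s1.
  rewrite -subr_le0 qE mulr_le0_ge0 ?subr_ge0 ?(ltW s1)//.
  by rewrite mulr_ge0_le0 ?powR_ge0// hneg// ltW.
Qed.

Theorem proposition11 (R : realType) (n : nat) :
  let e : R := expR 1 in
  let Ehat : R := e^-1 * (e - \sum_(k < n.+1) (k`!%:R)^-1) in
  let deltaE : R := (n`!%:R * (e - \sum_(k < n.+1) (k`!%:R)^-1))^-1 in
  [/\ is_minimum [set ME n delta | delta in `]0, n.+1%:R[] Ehat,
      0 < deltaE < n.+1%:R
    & ME n deltaE = Ehat].
Proof.
move=> e Ehat deltaE.
have e0 : 0 < e by exact: expR_gt0.
have mass1 m : poisson_mass m 1 = (m`!%:R)^-1 * e^-1 :> R.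
  by rewrite /poisson_mass expr1n div1r expRN.
have EhatE : Ehat = poisson_tail n 1.
  rewrite /Ehat /poisson_tail expRN -/e mulrBr mulVf ?gt_eqF//.
  rewrite [e^-1 * _]mulrC; congr (1 - _ / _).
  by apply: eq_bigr => k _; rewrite expr1n div1r.
have tail1 : 0 < poisson_tail n (1 : R) by rewrite poisson_tail_gt0.
have deltaE_tail : deltaE * poisson_tail n 1 = poisson_mass n 1.
  rewrite -EhatE mass1 /deltaE /Ehat invfM.
  have : e - \sum_(k < n.+1) (k`!%:R)^-1 != 0.
    by move: tail1; rewrite -EhatE /Ehat => /gt_eqF; apply: contraFN => /eqP ->; rewrite mulr0.
  move: (fact_neq0 R n) (e - _) => f0 d d0.
  by field; rewrite d0 f0 gt_eqF.
have delta_bounds : 0 < deltaE < n.+1%:R.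
  apply/andP; split.
    by rewrite -(pmulr_lgt0 _ tail1) deltaE_tail poisson_mass_gt0.
  rewrite -(ltr_pM2r tail1) deltaE_tail -[ltLHS]mul1r mul_poisson_mass.
  rewrite ltr_pM2l ?ltr0n// -subr_gt0 -poisson_tailS.
  exact: poisson_tail_gt0.
have ME_ge delta : 0 < delta < n.+1%:R -> Ehat <= ME n delta.
  (* At [s = 1] the value of [E n delta] does not depend on [delta]. *)
  move=> /(@ME_is_maximum R n)[_]; apply.
  by exists 1; rewrite ?E1// /= in_itv /= ler01.
have ME_deltaE : ME n deltaE = Ehat.
  apply/eqP; rewrite eq_le ME_ge// andbT.
  have [[s _ <-] _] := ME_is_maximum delta_bounds.
  rewrite EhatE -(E1 n deltaE); apply: E_le_E1.
  by rewrite /slope_excess -mul_poisson_mass mul1r deltaE_tail subrr.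
split=> //; split; first by exists deltaE; rewrite //= in_itv.
by move=> _ [delta dn <-]; apply: ME_ge; move: dn; rewrite /= in_itv.
Qed.
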